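(* Let $B=(V,E)$ be a (two-sided) generalized Bratteli diagram of bounded size with corresponding sequence $(t_n,L_n)_{n\in\mathbb N_0}$, equipped with the left-to-right ordering $\omega$. Assume that for every $N\in\mathbb N$ there exists $k\in\mathbb N$ such that $$t_{N+k}<\sum_{i=N}^{N+k-1}t_i .$$ Let $\varphi_B(\omega):X_B\to X_B$ be any Vershik map on $X_B$ corresponding to the order $\omega$. Then $\varphi_B(\omega)$ is not continuous. Moreover, every infinite maximal path is a point of discontinuity of $\varphi_B(\omega)$.
   Context: $\mathbb N=\{1,2,\dots\}$, $\mathbb N_0=\mathbb N\cup\{0\}$. A generalized Bratteli diagram is a graded graph $B=(V,E)$ with $V=\bigsqcup_{i\ge0}V_i$, $E=\bigsqcup_{i\ge0}E_i$, where every level $V_i$ is countably infinite, $E_i$ is a countable set of edges from $V_i$ to $V_{i+1}$ with source and range maps $s,r$ satisfying $s(E_i)=V_i$, $r(E_i)=V_{i+1}$, and $|r^{-1}(v)|<\infty$ for every $v\in V\setminus V_0$. The path space $X_B$ is the set of infinite paths $x=(x_i)_{i\ge0}$, $x_i\in E_i$, $r(x_i)=s(x_{i+1})$, with the topology generated by the cylinder sets $[\overline e]=\{x: x_0=e_0,\dots,x_n=e_n\}$, equivalently by the metric $\mathrm{dist}(x,y)=2^{-\min\{i:x_i\ne y_i\}}$. For $w\in V_n$, $v\in V_m$, $n<m$, $E(w,v)$ is the set of finite paths from $w$ to $v$. Standing assumptions on diagrams: $X_B$ has no isolated points, all classes of the tail equivalence relation ($x\sim y$ iff $x_i=y_i$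 for all large $i$) are infinite, and $B$ is connected as an undirected graph. Bounded size: every level $V_n$ is identified with $\mathbb Z$, and there are pairs of natural numbers $(t_n,L_n)_{n\in\mathbb N_0}$ such that for all $n\in\mathbb N_0$ and $v\in V_{n+1}$: $s(r^{-1}(v))\subset\{v-t_n,\dots,v+t_n\}$ and $|r^{-1}(v)|=\sum_{w\in V_n}|E(w,v)|\le L_n$. Convention: for each $n$, $t_n$ and $L_n$ are chosen minimal possible, and $E(v-t_n,v)$ and $E(v+t_n,v)$ are nonempty for all $n\in\mathbb N_0$ and all $v\in V_{n+1}$. Order: an ordered diagram carries a linear order on each finite set $r^{-1}(v)$, $v\in V\setminus V_0$. The order is left-to-right if for $e,f\in r^{-1}(v)$, $s(e)<s(f)$ implies $e<f$. A (finite or infinite) path is maximal (minimal) if each of its edges $e_i$ is maximal (minimal) in $r^{-1}(r(e_i))$; $X_{max}$, $X_{min}$ are the sets of infinite maximal, minimal paths. The map $\varphi_B:X_B\setminus X_{max}\to X_B\setminus X_{min}$ sends $x=(x_0,x_1,\dots)$ to $(g_0,\dots,g_{m-1},g_m,x_{m+1},\dots)$, where $m$ is the least index with $x_m$ not maximal, $g_m$ is the successor of $x_m$ in $r^{-1}(r(x_m))$ and $(g_0,\dots,g_{m-1})$ is the minimal path from $V_0$ to $s(g_m)$. A Vershik map is any extension of this map to a Borel bijection $X_B\to X_B$. *)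

(* Defs.v *)
From HB Require Import structures.
From mathcomp Require Import all_boot all_order all_algebra.
From mathcomp Require Import finmap.
From mathcomp Require Import all_classical.
From mathcomp Require Import topology measure.
From Stdlib Require Import Relations.

Set Implicit Arguments.
Unset Strict Implicit.
Unset Printing Implicit Defensive.

Import Order.TTheory GRing.Theory Num.Theory.

Local Open Scope classical_set_scope.

(* Generalized Bratteli diagrams with prescribed levels [V n]; [edge n] is the
   set of edges from [V n] to [V n.+1]. *)
Record bratteli (V : nat -> countType) := Bratteli {
  edge : nat -> countType;
  src : forall n, edge n -> V n;
  rng : forall n, edge n -> V n.+1;
  level_infinite : forall n, infinite_set [set: V n];
  src_surj : forall n (w : V n), exists e : edge n, src e = w;
  rng_surj : forall n (v : V n.+1), exists e : edge n, rng e = v;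
  fiber_finite : forall n (v : V n.+1),
    finite_set [set e : edge n | rng e = v]
}.

Section Diagram.
Context (V : nat -> countType) (B : bratteli V).

(* r^-1(v) *)
Definition fiber n (v : V n.+1) : set (edge B n) := [set e | rng e = v].

(* E(w, v) for w and v on consecutive levels *)
Definition edges_between n (w : V n) (v : V n.+1) : set (edge B n) :=
  [set e | src e = w /\ rng e = v].

Definition vertex : Type := {n : nat & V n}.

Definition joined (u w : vertex) : Prop :=
  exists n (e : edge B n), u = existT V n (src e) /\ w = existT V n.+1 (rng e).

Definition connected_diagram : Prop :=
  forall u w : vertex, clos_refl_sym_trans vertex joined u w.

Record path_space := Path {
  path_edge :> forall n, edge B n;
  path_adj : forall n, rng (path_edge n) = src (path_edge n.+1)
}.

HB.instance Definition _ := gen_eqMixin path_space.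
HB.instance Definition _ := gen_choiceMixin path_space.

(* The cylinder [(e_0, ..., e_n)]; it is empty if this is not a path. *)
Definition cylinder (e : forall i, edge B i) (n : nat) : set path_space :=
  [set x | forall i, (i <= n)%N -> x i = e i].

Definition cylinders : set (set path_space) :=
  [set C | exists e n, C = cylinder e n].

Lemma cylinders_cover : \bigcup_(C in cylinders) (C : set path_space) = setT.
Proof.
by apply/seteqP; split=> // x _; exists (cylinder x 0) => //; exists x, 0%N.
Qed.

Lemma cylinders_join (C D : set path_space) x :
  cylinders C -> cylinders D -> C x -> D x ->
  exists A : set path_space, [/\ cylinders A, A x & A `<=` C `&` D].
Proof.
move=> [e [n ->]] [f [m ->]] ex fx.
exists (cylinder x (maxn n m)); split; first by exists x, (maxn n m).
  by [].
move=> y yx; split=> i le_i.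
  by rewrite yx ?ex// (leq_trans le_i)// leq_maxl.
by rewrite yx ?fx// (leq_trans le_i)// leq_maxr.
Qed.

HB.instance Definition _ :=
  isBaseTopological.Build path_space cylinders_cover cylinders_join.

Definition no_isolated_points : Prop := isolated [set: path_space] = set0.

Definition tail_equiv (x y : path_space) : Prop :=
  exists N, forall i, (N <= i)%N -> x i = y i.

Definition infinite_tail_classes : Prop :=
  forall x, infinite_set [set y | tail_equiv x y].

Definition borel : set (set path_space) := <<s @open path_space >>.

Definition borel_bijection (phi : path_space -> path_space) : Prop :=
  bijective phi /\ (forall A, borel A -> borel (phi @^-1` A)).

(* A linear order on each fiber r^-1(v).  Only the values of [ele] on edges
   with the same range are meaningful. *)
Record edge_order := EdgeOrder {
  ele : forall n, rel (edge B n);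
  ele_refl : forall n (e : edge B n), ele e e;
  ele_anti : forall n (e f : edge B n),
    rng e = rng f -> ele e f -> ele f e -> e = f;
  ele_trans : forall n (e f g : edge B n),
    rng e = rng f -> rng f = rng g -> ele e f -> ele f g -> ele e g;
  ele_total : forall n (e f : edge B n),
    rng e = rng f -> ele e f || ele f e
}.

Section Ordered.
Variable omega : edge_order.

Definition elt n (e f : edge B n) : Prop := ele omega e f /\ e <> f.

Definition max_edge n (e : edge B n) : Prop :=
  forall f, fiber (rng e) f -> ele omega f e.

Definition min_edge n (e : edge B n) : Prop :=
  forall f, fiber (rng e) f -> ele omega e f.

Definition X_max : set path_space := [set x | forall i, max_edge (x i)].

(* [f] is the successor of [e] in the fiber containing [e]. *)
Definition successor n (e f : edge B n) : Prop :=
  [/\ fiber (rng e) f, elt e f &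
      forall g, fiber (rng e) g -> elt e g -> ele omega f g].

(* The graph of the partially defined map phi_B: for x outside [X_max],
   [vershik_graph x y] holds for exactly one y, namely phi_B(x).  That
   (y_0, ..., y_(m-1)) ends at s(y_m) is part of y being in [path_space]. *)
Definition vershik_graph (x y : path_space) : Prop :=
  exists m, [/\ forall i, (i < m)%N -> max_edge (x i),
                ~ max_edge (x m),
                successor (x m) (y m),
                forall i, (i < m)%N -> min_edge (y i) &
                forall i, (m < i)%N -> y i = x i].

Definition vershik_map (phi : path_space -> path_space) : Prop :=
  borel_bijection phi /\ (forall x, ~ X_max x -> vershik_graph x (phi x)).

End Ordered.
End Diagram.

(* All levels are the integers. *)
Definition Zlevels : nat -> countType := fun=> int.

Section BoundedSize.
Variable B : bratteli Zlevels.

Definition source_window n (t : nat) : Prop :=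
  forall v : int, @src _ B n @` @fiber _ B n v `<=`
    [set w : int | (v - t%:Z <= w <= v + t%:Z)%R].

Definition indegree_bound n (L : nat) : Prop :=
  forall v : int, (#|` fset_set (@fiber _ B n v)| <= L)%N.

(* The pairs (t_n, L_n) are positive, satisfy the two bounds, are the least
   positive integers doing so, and the extreme edges at v +- t_n exist. *)
Record bounded_size (t L : nat -> nat) : Prop := BoundedSize {
  t_gt0 : forall n, (0 < t n)%N;
  L_gt0 : forall n, (0 < L n)%N;
  t_window : forall n, source_window n (t n);
  L_bound : forall n, indegree_bound n (L n);
  t_minimal : forall n k, (0 < k)%N -> source_window n k -> (t n <= k)%N;
  L_minimal : forall n k, (0 < k)%N -> indegree_bound n k -> (L n <= k)%N;
  left_edge : forall n (v : int),
    @edges_between _ B n (v - (t n)%:Z)%R v !=set0;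
  right_edge : forall n (v : int),
    @edges_between _ B n (v + (t n)%:Z)%R v !=set0
}.

Definition left_to_right (omega : edge_order B) : Prop :=
  forall n (e f : edge B n), rng e = rng f ->
    (src e < src f :> int)%R -> elt omega e f.

End BoundedSize.

(* Main.v *)
Require Import Defs.
From HB Require Import structures.
From mathcomp Require Import all_boot all_order all_algebra.
From mathcomp Require Import all_classical.
From mathcomp Require Import topology.
From mathcomp Require Import zify.

(** All edges into a vertex [v] of level [n.+1] start between [v - t n] and
    [v + t n], and both extreme sources occur.  As the order goes from left to
    right, a maximal edge into [v] starts at [v + t n] and a minimal one at
    [v - t n] ([src_max_edge], [src_min_edge]).  Hence, writing [S m] for
    [\sum_(i < m) t i], a path that is maximal below level [m] moves left by
    exactly [S m] on its way to level [m], and one that is minimal there moves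
    right by [S m].

    Let [x] be an infinite maximal path starting at [a], and let [phi x] start
    at [b].  If [phi] were continuous at [x], then for all large [m] every path
    [z] that agrees with [x] below level [m] would have an image starting at
    [b].  Choose [z] to follow at level [m] the leftmost edge into
    [src (x m) + t m] ([path_through]): this edge is not maximal, so [phi z] is
    minimal below level [m] and then takes the successor of that edge.  The
    successor has the same range, so its source [b + S m] is at most
    [src (x m) + 2 t m = a - S m + 2 t m].  Thus [2 S m - 2 t m <= a - b] for
    all large [m] ([continuity_sum_bound]).  But the hypothesis gives, for each
    [N], an [m > N] with [t m < S m - S N], so that [2 S m - 2 t m > 2 S N >= 2 N]
    is unbounded along such [m].

    Discontinuity of [phi] then follows because infinite maximal paths exist:
    the sources of maximal edges are prescribed, so the maximal edges into the
    vertices [- S n.+1] fit together ([X_max_nonempty]). *)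

Set Implicit Arguments.
Unset Strict Implicit.
Unset Printing Implicit Defensive.

Import Order.TTheory GRing.Theory Num.Theory.

Local Open Scope classical_set_scope.

(** * Cylinders, gluing of paths and maximal edges *)

Section Diagram.
Context (V : nat -> countType) (B : bratteli V).

Lemma nbhs_cylinder (x : path_space B) n : nbhs x (cylinder x n).
Proof.
rewrite nbhsE; exists (cylinder x n) => //; split=> //.
exists [set cylinder x n]; last by rewrite bigcup_set1.
by move=> _ ->; exists x, n.
Qed.

Lemma nbhs_sub_cylinder (x : path_space B) (A : set (path_space B)) :
  nbhs x A -> exists n, cylinder x n `<=` A.
Proof.
rewrite nbhsE => -[U [[D sD <-] [C DC Cx]] UA].
have [e [n eC]] := sD _ DC; rewrite {C}eC /= in DC Cx.
exists n => y yx; apply: UA; exists (cylinder e n) => //= i le_in.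
by rewrite yx// Cx.
Qed.

(** A path can be made to leave [x] at any level [m] through any edge that
    starts where [x] is, because every vertex emits an edge. *)
Lemma path_through (x : path_space B) m (f : edge B m) :
  src f = src (x m) ->
  exists z : path_space B, (forall i, (i < m)%N -> z i = x i) /\ z m = f.
Proof.
move=> srcf.
have [out outE] : exists out : forall n, V n -> edge B n,
    forall n w, src (out n w) = w.
  exists (fun n w => sval (cid (@src_surj _ B n w))) => n w.
  exact: svalP (cid (@src_surj _ B n w)).
(* [dfwith] transports [f] along [j = m] without an explicit cast *)
pose F := @dfwith nat (fun n => edge B n) (path_edge x) m f.
pose z := fix z n : edge B n :=
  if n is k.+1 then if (k.+1 <= m)%N then F k.+1 else out k.+1 (rng (z k))
  else F 0%N.
have zS n :
  z n.+1 = if (n.+1 <= m)%N then F n.+1 else out n.+1 (rng (z n)) by [].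
have zF n : (n <= m)%N -> z n = F n by case: n => // n; rewrite zS => ->.
have Fm : F m = f by rewrite /F dfwithin.
have Fx n : (n < m)%N -> F n = x n.
  by move=> lt_nm; rewrite /F dfwithout// neq_ltn lt_nm orbT.
have adj n : rng (z n) = src (z n.+1).
  rewrite zS; case: ltnP => [lt_nm|_]; last by rewrite outE.
  rewrite (zF _ (ltnW lt_nm)) Fx// path_adj.
  move: (lt_nm); rewrite leq_eqVlt => /predU1P[->|lt_n1m].
    by rewrite Fm srcf.
  by rewrite Fx.
exists (Path adj); split=> [i lt_im|] /=; last by rewrite zF.
by rewrite (zF _ (ltnW lt_im)) Fx.
Qed.

(** Fibers are finite, so the maximum is found by induction on an enumeration. *)
Lemma max_edge_exists (omega : edge_order B) n (v : V n.+1) :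
  exists e : edge B n, rng e = v /\ max_edge omega e.
Proof.
have /finite_seqP[s sE] := @fiber_finite _ B n v.
have [e0 e0v] := @rng_surj _ B n v.
have memE e : (rng e = v) <-> (e \in s).
  by have := congr1 (fun A : set _ => A e) sE => /= ->.
have sv e : e \in s -> rng e = v by move/memE.
suff [e [ev es]] : exists e, rng e = v /\ {in s, forall f, ele omega f e}.
  by exists e; split=> // f; rewrite /fiber/= ev => /memE; apply: es.
elim: s sv {sE memE} => [|g s IHs] sv; first by exists e0.
have [|e [ev es]] := IHs; first by move=> f fs; apply: sv; rewrite inE fs orbT.
have gv : rng g = v by apply: sv; rewrite inE eqxx.
have sv' f : f \in s -> rng f = v by move=> fs; apply: sv; rewrite inE fs orbT.
have /orP[ge|eg] : ele omega g e || ele omega e g.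
  by apply: ele_total; rewrite gv.
  by exists e; split=> // f; rewrite inE => /predU1P[->|/es].
exists g; split=> // f; rewrite inE => /predU1P[->|fs]; first exact: ele_refl.
by apply: ele_trans (es _ fs) eg; rewrite ?ev ?gv ?sv'.
Qed.

End Diagram.

(** * Displacement along maximal and minimal paths *)

Section BoundedSize.
Context (B : bratteli Zlevels) (t L : nat -> nat) (omega : edge_order B).
Hypothesis bsB : bounded_size B t L.
Hypothesis ltrB : left_to_right omega.

Lemma src_le n (e : edge B n) : (src e <= rng e + (t n)%:Z :> int)%R.
Proof.
have /(_ (src e)) := t_window bsB (n := n) (v := rng e).
by case/(_ (ex_intro2 _ _ e erefl erefl))/andP.
Qed.

Lemma src_ge n (e : edge B n) : (rng e - (t n)%:Z <= src e :> int)%R.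
Proof.
have /(_ (src e)) := t_window bsB (n := n) (v := rng e).
by case/(_ (ex_intro2 _ _ e erefl erefl))/andP.
Qed.

Lemma src_max_edge n (e : edge B n) :
  max_edge omega e -> (src e = rng e + (t n)%:Z :> int)%R.
Proof.
move=> maxe; apply/eqP; rewrite eq_le src_le leNgt; apply/negP => lt_e.
have [f [fs fr]] := right_edge bsB n (rng e).
have [|le_ef neq] := ltrB (e := e) (f := f) (esym fr); first by rewrite fs.
by apply: neq; apply: (ele_anti (esym fr) le_ef); apply: maxe.
Qed.

Lemma src_min_edge n (e : edge B n) :
  min_edge omega e -> (src e = rng e - (t n)%:Z :> int)%R.
Proof.
move=> mine; apply/eqP; rewrite eq_le src_ge andbT leNgt; apply/negP => lt_e.
have [f [fs fr]] := left_edge bsB n (rng e).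
have [|le_fe neq] := ltrB (e := f) (f := e) fr; first by rewrite fs.
by apply: neq; apply: (ele_anti fr le_fe); apply: mine.
Qed.

Lemma src_max_path (x : path_space B) m :
  (forall i, (i < m)%N -> max_edge omega (x i)) ->
  (src (x m) = src (x 0%N) - (\sum_(0 <= i < m) t i)%N%:Z :> int)%R.
Proof.
elim: m => [|m IHm] maxx; first by rewrite big_nil subr0.
have := src_max_edge (maxx m (ltnSn m)); rewrite path_adj.
rewrite IHm => [|i lt_im]; last by apply: maxx; rewrite ltnW.
by rewrite big_nat_recr//= PoszD opprD addrA => ->; rewrite addrK.
Qed.

Lemma src_min_path (x : path_space B) m :
  (forall i, (i < m)%N -> min_edge omega (x i)) ->
  (src (x m) = src (x 0%N) + (\sum_(0 <= i < m) t i)%N%:Z :> int)%R.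
Proof.
elim: m => [|m IHm] minx; first by rewrite big_nil addr0.
have := src_min_edge (minx m (ltnSn m)); rewrite path_adj.
rewrite IHm => [|i lt_im]; last by apply: minx; rewrite ltnW.
by rewrite big_nat_recr//= PoszD addrA => ->; rewrite subrK.
Qed.

Lemma X_max_nonempty : X_max omega !=set0.
Proof.
pose v n : int := (- (\sum_(0 <= i < n) t i)%N%:Z)%R.
have ex n := cid (max_edge_exists omega (v n.+1 : Zlevels n.+1)).
pose e n := sval (ex n).
have eP n : rng (e n) = v n.+1 /\ max_edge omega (e n) := svalP (ex n).
have adj n : rng (e n) = src (e n.+1).
  have [en _] := eP n; have [en1 /src_max_edge ->] := eP n.+1.
  rewrite en en1 /v [in RHS]big_nat_recr//= PoszD opprD.
  by rewrite subrK.
by exists (Path adj) => i /=; have [] := eP i.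
Qed.

(** * Discontinuity at maximal paths *)

Lemma vershik_graph_first_nonmax (x y : path_space B) m :
  (forall i, (i < m)%N -> max_edge omega (x i)) -> ~ max_edge omega (x m) ->
  vershik_graph omega x y ->
  (forall i, (i < m)%N -> min_edge omega (y i)) /\
  successor omega (x m) (y m).
Proof.
move=> maxx nmax [k [maxk nmaxk succ miny _]].
suff -> : m = k by [].
by case: (ltngtP m k) => [/maxk|/maxx|].
Qed.

(** Both sides bound the source of the edge of [phi z] at level [m], where [z]
    leaves [x] at level [m] through a leftmost edge.  Continuity makes [phi z]
    start where [phi x] does, and minimality below level [m] then determines
    that source; on the other hand, the edge is the successor of an edge
    starting at [src (x m)], so it starts at most [2 t m] to the right of it. *)
Lemma continuity_sum_bound (phi : path_space B -> path_space B)
    (x : path_space B) :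
  vershik_map omega phi -> X_max omega x -> {for x, continuous phi} ->
  exists n, forall m, (n < m)%N ->
    (src (phi x 0%N) + (\sum_(0 <= i < m) t i)%N%:Z <=
     src (x 0%N) - (\sum_(0 <= i < m) t i)%N%:Z + (t m)%:Z *+ 2 :> int)%R.
Proof.
move=> [_ phiP] maxx cphi.
have [n sub] := nbhs_sub_cylinder (cphi _ (nbhs_cylinder (phi x) 0)).
exists n => m lt_nm.
have [f [fs fr]] := left_edge bsB m (src (x m) + (t m)%:Z : int)%R.
have srcf : src f = src (x m) by rewrite fs addrK.
have [z [zx zm]] := path_through srcf.
have maxz i : (i < m)%N -> max_edge omega (z i).
  by move=> lt_im; rewrite zx.
have nmaxz : ~ max_edge omega (z m).
  rewrite zm => /src_max_edge; rewrite srcf fr => xE.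
  by have := t_gt0 bsB m; move: (src (x m) : int) xE => a; lia.
have z0 : phi z 0%N = phi x 0%N.
  apply: (sub z) => // i le_in.
  by rewrite zx// (leq_ltn_trans le_in).
have [|minz [gr _ _]] := vershik_graph_first_nonmax maxz nmaxz (phiP z _).
  by move=> /(_ m).
rewrite -z0 -src_min_path// -src_max_path//.
by rewrite mulr2n addrA -fr -zm -gr src_le.
Qed.

End BoundedSize.

Theorem theorem3p10 (B : bratteli Zlevels) (t L : nat -> nat)
    (omega : edge_order B)
    (phi : path_space B -> path_space B) :
  no_isolated_points B ->
  infinite_tail_classes B ->
  connected_diagram B ->
  bounded_size B t L ->
  left_to_right omega ->
  (forall N : nat, (1 <= N)%N ->
     exists k : nat, (1 <= k)%N /\ (t (N + k) < \sum_(N <= i < N + k) t i)%N) ->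
  vershik_map omega phi ->
  ~ continuous phi /\
  (forall x : path_space B, X_max omega x -> ~ {for x, continuous phi}).
Proof.
move=> _ _ _ bsB ltrB tP phiP.
have disc x : X_max omega x -> ~ {for x, continuous phi}.
  move=> maxx /(continuity_sum_bound bsB ltrB phiP maxx)[n bound].
  move: (src (x 0%N) : int) (src (phi x 0%N) : int) bound => a b bound.
  (* beyond the range of the bound, and with [2 N > a - b] *)
  pose N := (n + `|a - b|%N).+1.
  have [k [k_gt0 ltk]] := tP N isT.
  have le_N : (N <= \sum_(0 <= i < N) t i)%N.
    rewrite -[leqLHS]muln1 -[X in (X * 1)%N]subn0 -sum_nat_const_nat.
    by apply: leq_sum => i _; apply: t_gt0 bsB _.
  have := bound (N + k)%N; rewrite (big_cat_nat (n := N)) ?leq_addr//=.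
  by rewrite /N in le_N ltk *; lia.
split=> // cphi; have [x maxx] := X_max_nonempty bsB ltrB.
exact: (disc x maxx (cphi x)).
Qed.
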